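(* Let $\alpha,\beta,\gamma\in\mathbb{Z}$ with $\gamma>0$ and $\alpha^\gamma\neq1\neq\beta^\gamma$, let $p$ be a prime, let $\mu$ be an integer that is inverse of $\beta$ modulo the order of $b$, and write $\gamma=p^nk$, where $n\ge0$ and $p\nmid k$. Suppose that $p\mid(\alpha-1)$ and $p\mid(\beta-1)$. Let $M_p$ be the normal closure in $G_p$ of the $p^n-1$ elements $$[a^\alpha,b^\mu][a,b]^{-1},\ \dots,\ [a^{\alpha^{p^n-1}},b^{\mu^{p^n-1}}][a,b]^{-1}.$$ Then $M_p=N_p$. In particular, if $p\nmid\gamma$, then $G_p$ imbeds as the sole Sylow $p$-subgroup of $W$.
   Context: Conventions: $x^y=y^{-1}xy$, ${}^y x=yxy^{-1}$, $[x,y]=x^{-1}y^{-1}xy$. $W=\langle X,Y,Z\mid X^Z=X^\alpha,\ {}^Z Y=Y^\beta,\ Z^\gamma=[X,Y]\rangle$ is the Wamsley group (finite), and $G=\langle A,B\mid A^{[A,B]}=A^{\alpha^\gamma},\ {}^{[A,B]}B=B^{\beta^\gamma}\rangle$ is the Macdonald group, known to be finite and nilpotent. $N$ is the kernel of the homomorphism $\Omega:G\to W$, $A\mapsto X$, $B\mapsto Y$. $G_p$ and $N_p=N\cap G_p$ are the Sylow $p$-subgroups of $G$ and $N$, and $a,b$ are the images of $A,B$ under the canonical projection $G\to G_p$. *)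

(* Defs.v *)
From HB Require Import structures.
From mathcomp Require Import all_boot all_order all_algebra all_fingroup all_solvable.

Set Implicit Arguments.
Unset Strict Implicit.
Unset Printing Implicit Defensive.

Local Open Scope group_scope.

Definition expgz (T : groupType) (x : T) (m : int) : T :=
  match m with
  | Posz n => x ^+ n
  | Negz n => x ^- n.+1
  end.

(* [presented2 rel x y] : the group [T], with generators [x] and [y], is
   presented by the relations [rel].  The universal property ranges over all
   groups, finite or not. *)
Definition presented2 (rel : forall H : groupType, H -> H -> Prop)
    (T : groupType) (x y : T) : Prop :=
  [/\ rel T x y,
      forall (H : groupType) (u v : H), rel H u v ->
        exists f : {multiplicative T -> H}, f x = u /\ f y = v
    & forall (H : groupType) (f g : {multiplicative T -> H}),
        f x = g x -> f y = g y -> f =1 g].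

Definition presented3 (rel : forall H : groupType, H -> H -> H -> Prop)
    (T : groupType) (x y z : T) : Prop :=
  [/\ rel T x y z,
      forall (H : groupType) (u v w : H), rel H u v w ->
        exists f : {multiplicative T -> H}, [/\ f x = u, f y = v & f z = w]
    & forall (H : groupType) (f g : {multiplicative T -> H}),
        f x = g x -> f y = g y -> f z = g z -> f =1 g].

Definition macdonald_rel (alpha beta : int) (gamma : nat)
    (T : groupType) (x y : T) : Prop :=
  x ^ [~ x, y] = expgz x (alpha ^+ gamma)%R /\
  [~ x, y] * y * [~ x, y]^-1 = expgz y (beta ^+ gamma)%R.

Definition wamsley_rel (alpha beta : int) (gamma : nat)
    (T : groupType) (x y z : T) : Prop :=
  [/\ x ^ z = expgz x alpha,
      z * y * z^-1 = expgz y beta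
    & z ^+ gamma = [~ x, y]].

Definition is_macdonald (alpha beta : int) (gamma : nat)
    (T : groupType) (x y : T) : Prop :=
  presented2 (macdonald_rel alpha beta gamma) x y.

Definition is_wamsley (alpha beta : int) (gamma : nat)
    (T : groupType) (x y z : T) : Prop :=
  presented3 (wamsley_rel alpha beta gamma) x y z.

(* A finite nilpotent group is the internal direct product of its Sylow
   p-subgroup [P] and of its p'-core; this is the projection onto [P]. *)
Definition sylow_proj (gT : finGroupType) (p : nat) (P : {set gT}) (x : gT) : gT :=
  divgr P 'O_p^'([set: gT]) x.

Definition normal_closure (gT : finGroupType) (S G : {set gT}) : {set gT} :=
  <<class_support S G>>.

Definition comm_quotients (gT : finGroupType) (alpha mu : int) (q : nat)
    (a b : gT) : {set gT} :=
  [set [~ expgz a (alpha ^+ i)%R, expgz b (mu ^+ i)%R] * [~ a, b]^-1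
     | i : 'I_q & (0 < i)%N].

(* Main.v *)
Require Import Defs.
From HB Require Import structures.
From mathcomp Require Import all_boot all_order all_algebra all_fingroup all_solvable.

(** Write P for the Sylow p-subgroup of G and M for the normal closure.

    M is contained in the kernel: a and b are powers of A and B, so conjugation
    by Z raises their images in W to the powers alpha and mu. It centralises the
    commutator of these images, which is the p-part of Z ^ gamma. Hence the
    commutators of the successive images under conjugation by Z all coincide
    ([normal_closure_sub_ker]).

    Conversely, let H = P / M, generated by the images x, y of a, b, with
    commutator c. By the choice of M, the commutator of x ^ (alpha ^ i) and
    y ^ (mu ^ i) is c for i < p ^ n. It is also c for i = p ^ n, because a power
    of c acts on x and y as the p ^ n-th iterate of x |-> x ^ alpha,
    y |-> y ^ mu: k is invertible modulo the powers of p, while alpha and beta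
    are 1 modulo p ([comm_expgz_pn]). The presentation of G thus provides
    an endomorphism zeta of H with zeta x = x ^ alpha, zeta y = y ^ mu and
    zeta c = c, and its gamma-th iterate is the conjugation by c. So H embeds in
    a finite group containing an element w with w ^ gamma = c that induces zeta
    on H ([cyclic_extension]); there x, y, w satisfy the Wamsley relations
    ([wamsley_extension]). The resulting morphism from W shows that every element
    of P killed in W lies in M ([ker_sub_normal_closure]).

    If p does not divide gamma, then n = 0, so M is trivial and P embeds in W.
    The image of G in W is the nilpotent normal subgroup generated by X and Y,
    of index dividing gamma, so the image of P is a normal Sylow p-subgroup of W
    ([wamsley_Sylow]). *)

Import GRing.Theory Num.Theory.

Set Implicit Arguments.
Unset Strict Implicit.
Unset Printing Implicit Defensive.

Local Open Scope group_scope.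

(** * Integer powers in finite groups *)

(** In a finite group, an integer power is the natural power by the residue of
    the exponent modulo any positive multiple of the order. *)
Lemma expgz_mod_expn (T : finGroupType) (x : T) (m : int) (N : nat) :
  (0 < N)%N -> #[x] %| N -> expgz x m = x ^+ `|(m %% N)%Z|%N.
Proof.
move=> N_gt0 /dvdnP[d defN]; have xN : x ^+ N = 1.
  by rewrite defN mulnC expgM expg_order expg1n.
have N_neq0 : (N%:Z)%R != 0%R by rewrite eqz_nat -lt0n.
case: m => m /=; first by rewrite modz_nat /= expg_mod.
(* - (m + 1) and its remainder r modulo N are such that r + (m + 1) is a
   multiple of N *)
have r_ge0 := modz_ge0 (Negz m) N_neq0.
have := divz_eq (Negz m) N; set r := (_ %% _)%Z in r_ge0 *; set q := (_ %/ _)%Z.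
case: r r_ge0 => // r _ /=; case: q => q eq_m.
  by move: eq_m; rewrite -PoszM -PoszD.
apply/eqP; rewrite eq_invg_mul -expgD; apply/eqP.
suff -> : (m.+1 + r = N * q.+1)%N by rewrite expgM xN expg1n.
apply/eqP; rewrite -eqz_nat PoszD PoszM.
have -> : Posz r = (Negz m - Negz q * N%:Z)%R by rewrite eq_m addrAC subrr add0r.
by rewrite !NegzE mulNr opprK addrA subrr add0r mulrC.
Qed.

Lemma eq_expgz (T : finGroupType) (x : T) (m m' : int) :
  (m = m' %[mod #[x]])%Z -> expgz x m = expgz x m'.
Proof. by move=> eq_m; rewrite !(@expgz_mod_expn _ _ _ #[x]) ?eq_m. Qed.

Lemma expgzM (T : finGroupType) (x : T) (m m' : int) :
  expgz x (m * m')%R = expgz (expgz x m) m'.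
Proof.
have ox : #[expgz x m] %| #[x].
  by rewrite (@expgz_mod_expn _ _ _ #[x]) // orderXdvd.
rewrite [LHS](@expgz_mod_expn _ _ _ #[x]) // [RHS](@expgz_mod_expn _ _ _ #[x]) //.
rewrite (@expgz_mod_expn _ _ m #[x]) // -expgM.
have o0 : (#[x]%:Z)%R != 0%R by rewrite eqz_nat -lt0n.
apply/eqP; rewrite eq_expg_mod_order -eqz_nat -!modz_nat PoszM.
by rewrite !gez0_abs ?modz_ge0 // modz_mod modzMm.
Qed.

Lemma expgz1 (T : groupType) (x : T) : expgz x 1%R = x.
Proof. exact: expg1. Qed.

Lemma morph_expgz (aT rT : finGroupType) (D : {group aT})
    (f : {morphism D >-> rT}) (x : aT) (m : int) :
  x \in D -> f (expgz x m) = expgz (f x) m.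
Proof. by move=> Dx; case: m => m /=; rewrite ?morphV ?groupX ?morphX. Qed.

Lemma expgzJ (T : finGroupType) (x y : T) (m : int) :
  expgz x m ^ y = expgz (x ^ y) m.
Proof. by case: m => m /=; rewrite ?conjVg conjXg. Qed.

Lemma mem_expgz (T : finGroupType) (G : {group T}) (x : T) (m : int) :
  x \in G -> expgz x m \in G.
Proof. by move=> Gx; case: m => m /=; rewrite ?groupV groupX. Qed.

Lemma expgz_exp1 (T : finGroupType) (x : T) (m : int) (i : nat) :
  expgz x m = x -> expgz x (m ^+ i)%R = x.
Proof.
move=> fx; elim: i => [|i IHi]; first by rewrite expr0 expgz1.
by rewrite exprS expgzM fx.
Qed.

Lemma expr_inv_mod (d : int) (m m' : int) (i : nat) :
  (m * m' = 1 %[mod d])%Z -> (m ^+ i * m' ^+ i = 1 %[mod d])%Z.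
Proof. by move=> eq1; rewrite -exprMn -modzXm eq1 modzXm expr1n. Qed.

(** If m is 1 modulo p, then m ^ (p ^ N) is 1 modulo p ^ N. *)
Lemma dvdz_exp_subr1 (p : nat) (m : int) (N : nat) :
  (p %| (m - 1)%R)%Z -> ((p ^ N)%N %| (m ^+ (p ^ N) - 1)%R)%Z.
Proof.
move=> pm; elim: N => [|N IHN]; first by rewrite expn0 dvd1z.
(* for c = m ^ (p ^ N), c ^ p - 1 is c - 1 times a sum of p terms that are all 1 modulo p *)
rewrite expnS [X in (X %| _)%Z]PoszM mulnC exprM subrX1 [(p%:Z * _)%R]mulrC.
apply: dvdz_mul => //; set c := (m ^+ _)%R.
have c1 : (p %| (c - 1)%R)%Z by rewrite /c subrX1 dvdz_mulr.
have -> : (\sum_(i < p) c ^+ i = \sum_(i < p) (c ^+ i - 1) + p%:Z)%R.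
  by rewrite big_split /= sumrN sumr_const card_ord natz addrNK.
apply: rpredD (dvdzz _).
by apply: rpred_sum => i _; rewrite subrX1 dvdz_mulr.
Qed.

(** If m is 1 modulo p, then the p ^ N-th iterate of the m-th power map fixes
    the elements of order dividing p ^ N. *)
Lemma expgz_pX (T : finGroupType) (p : nat) (x : T) (m : int) (N : nat) :
  #[x] %| p ^ N -> (p %| (m - 1)%R)%Z -> expgz x (m ^+ (p ^ N))%R = x.
Proof.
move=> ox pm; rewrite -[RHS]expgz1; apply: eq_expgz; apply/eqP.
rewrite eqz_mod_dvd; apply: (dvdz_trans _ (dvdz_exp_subr1 N pm)).
by rewrite dvdzE.
Qed.

(** * Extending a finite group by a root of an element *)

(** The group generated by [H] and an element w with w ^ g.+1 = c that acts on
    [H] by [zeta] is realised by permutations of ['I_g.+1 * H]: the pair (i, h)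
    stands for w ^ i * h, and the group acts by right multiplication. *)

Section CyclicExtension.

Variables (H : finGroupType) (zeta : {morphism [set: H] >-> H}) (c : H) (g : nat).
Hypothesis zeta_c : zeta c = c.
Hypothesis zeta_iter : forall h, iter g.+1 zeta h = h ^ c.

Let zetaM : {morph zeta : h h' / h * h'}.
Proof. by move=> h h'; rewrite morphM ?inE. Qed.

(** Right multiplication by h: (w ^ i * x) * h = w ^ i * (x * h). *)
Definition ext_right (h : H) (u : 'I_g.+1 * H) : 'I_g.+1 * H := (u.1, u.2 * h).

(** Right multiplication by w: (w ^ i * x) * w = w ^ i.+1 * zeta x, where
    w ^ g.+1 = c when i = g. *)
Definition ext_root (u : 'I_g.+1 * H) : 'I_g.+1 * H :=
  if (u.1 < g)%N then (inord u.1.+1, zeta u.2) else (ord0, c * zeta u.2).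

Lemma ext_right_inj (h : H) : injective (ext_right h).
Proof. by move=> [i x] [j y] [-> /mulIg->]. Qed.

Lemma iter_ext_root_small (i k : nat) (h : H) :
  (i + k <= g)%N ->
  iter k ext_root (inord i, h) = (inord (i + k), iter k zeta h).
Proof.
elim: k => [|k IHk] le_g; first by rewrite addn0.
rewrite addnS in le_g *; rewrite !iterS IHk 1?ltnW //.
by rewrite /ext_root /= inordK ?le_g // ltnW.
Qed.

(** The relation w ^ g.+1 = c. *)
Lemma iter_ext_root (u : 'I_g.+1 * H) :
  iter g.+1 ext_root u = ext_right c u.
Proof.
case: u => i h; have le_i : (i <= g)%N by rewrite -ltnS.
have {1}-> : iter g.+1 ext_root = iter (i + (g - i).+1) ext_root.
  by rewrite addnS subnKC.
rewrite iterD iterS -{3}[i]inord_val iter_ext_root_small subnKC //.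
rewrite [ext_root (inord g, _)]/ext_root /= inordK // ltnn.
have -> : ord0 = inord 0 :> 'I_g.+1 by apply: val_inj; rewrite /= inordK.
rewrite iter_ext_root_small // add0n inord_val; congr (_, _) => /=.
have -> t : iter i zeta (c * t) = c * iter i zeta t.
  by elim: (nat_of_ord i) => //= j ->; rewrite zetaM zeta_c.
by rewrite -iterS -iterD addnS subnKC // zeta_iter -conjgC.
Qed.

(** Some power of [ext_root] is injective, so [ext_root] itself is. *)
Lemma ext_root_inj : injective ext_root.
Proof.
move=> u v eq_uv; apply: (@ext_right_inj c).
by rewrite -!iter_ext_root !iterSr eq_uv.
Qed.

(** An endomorphism whose g.+1-st iterate is the conjugation by an element c that
    it fixes is induced by a (g.+1)-st root of c in a larger finite group. *)
Lemma cyclic_extension :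
  exists (E : finGroupType) (R : {morphism [set: H] >-> E}) (w : E),
    [/\ 'injm R, forall h, R h ^ w = R (zeta h) & w ^+ g.+1 = R c].
Proof.
pose R h : {perm 'I_g.+1 * H} := perm (@ext_right_inj h).
have RM : {in [set: H] &, {morph R : h h' / h * h'}}.
  by move=> h h' _ _; apply/permP=> u; rewrite permM !permE /ext_right /= mulgA.
exists {perm 'I_g.+1 * H}, (Morphism RM), (perm ext_root_inj); split.
- apply/injmP=> h h' _ _ /permP/(_ (ord0, 1)); rewrite !permE => -[].
  by rewrite !mul1g.
- move=> h; apply: (canLR (mulKg _)).
  apply/permP=> -[i x]; rewrite !permM !permE /ext_root /ext_right /=.
  by case: ifP => _ /=; rewrite zetaM ?mulgA.
- apply/permP=> u; rewrite permX permE -iter_ext_root.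
  by apply: eq_iter => v; rewrite permE.
Qed.

End CyclicExtension.

(** * Finite groups given by presentations *)

Lemma presented2_morphism (rel : forall H : groupType, H -> H -> Prop)
    (T : finGroupType) (x y : T) (H : finGroupType) (u v : H) :
  presented2 rel x y -> rel H u v ->
  exists f : {morphism [set: T] >-> H}, f x = u /\ f y = v.
Proof.
case=> _ ex_f _ /ex_f[f fE].
by exists (Morphism (in2W (@gmulfM _ _ f) : {in [set: T] &, {morph f : a b / a * b}})).
Qed.

Lemma presented3_morphism (rel : forall H : groupType, H -> H -> H -> Prop)
    (T : finGroupType) (x y z : T) (H : finGroupType) (u v w : H) :
  presented3 rel x y z -> rel H u v w ->
  exists f : {morphism [set: T] >-> H}, [/\ f x = u, f y = v & f z = w].
Proof.
case=> _ ex_f _ /ex_f[f fE].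
by exists (Morphism (in2W (@gmulfM _ _ f) : {in [set: T] &, {morph f : a b / a * b}})).
Qed.

(** The inclusion of the subgroup generated by the two generators, composed
    with the morphism onto this subgroup given by the presentation, is the
    identity because it fixes the generators; so the subgroup is everything.
    The premise says that the relations also hold in the subgroup. *)
Lemma presented2_gen (rel : forall H : groupType, H -> H -> Prop)
    (T : finGroupType) (x y : T) :
  presented2 rel x y ->
  rel (subg_of <<[set x; y]>>) (subg _ x) (subg _ y) ->
  <<[set x; y]>> = [set: T].
Proof.
case=> _ ex_f uniq_f /ex_f[r [rx ry]].
pose s t := sgval (r t).
have sM : {morph s : t t' / t * t'} by move=> t t'; rewrite /s gmulfM.
pose s' : {multiplicative T -> T} := HB.pack s (isMultiplicative.Build T T s sM).
have xyS : {subset [set x; y] <= <<[set x; y]>>} by apply/subsetP/subset_gen.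
apply/eqP; rewrite eqEsubset subsetT; apply/subsetP=> t _.
have <- : s' t = t; last exact: subgP.
by apply: (uniq_f _ s' idfun); rewrite /= /s ?rx ?ry subgK // xyS ?set21 ?set22.
Qed.

Lemma presented3_gen (rel : forall H : groupType, H -> H -> H -> Prop)
    (T : finGroupType) (x y z : T) :
  presented3 rel x y z ->
  rel (subg_of <<[set x; y; z]>>) (subg _ x) (subg _ y) (subg _ z) ->
  <<[set x; y; z]>> = [set: T].
Proof.
case=> _ ex_f uniq_f /ex_f[r [rx ry rz]].
pose s t := sgval (r t).
have sM : {morph s : t t' / t * t'} by move=> t t'; rewrite /s gmulfM.
pose s' : {multiplicative T -> T} := HB.pack s (isMultiplicative.Build T T s sM).
have xyS : {subset [set x; y; z] <= <<[set x; y; z]>>} by apply/subsetP/subset_gen.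
apply/eqP; rewrite eqEsubset subsetT; apply/subsetP=> t _.
have <- : s' t = t; last exact: subgP.
by apply: (uniq_f _ s' idfun); rewrite /= /s ?rx ?ry ?rz subgK // xyS // !inE eqxx ?orbT.
Qed.

Lemma is_macdonald_gen (alpha beta : int) (gamma : nat) (T : finGroupType)
    (x y : T) :
  is_macdonald alpha beta gamma x y -> <<[set x; y]>> = [set: T].
Proof.
move=> pres; apply: (presented2_gen pres); have [[xc yc] _ _] := pres.
pose S := <<[set x; y]>>%G; have Sx : x \in S by rewrite mem_gen ?set21.
have Sy : y \in S by rewrite mem_gen ?set22.
split; rewrite -morphR // -?morphJ ?groupR //.
  by rewrite xc morph_expgz.
by rewrite -morphV ?groupR // -!morphM ?groupM ?groupV ?groupR // yc morph_expgz.
Qed.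

Lemma is_wamsley_gen (alpha beta : int) (gamma : nat) (T : finGroupType)
    (x y z : T) :
  is_wamsley alpha beta gamma x y z -> <<[set x; y; z]>> = [set: T].
Proof.
move=> pres; apply: (presented3_gen pres); have [[xz yz zg] _ _] := pres.
pose S := <<[set x; y; z]>>%G; have [Sx Sy Sz] : [/\ x \in S, y \in S & z \in S].
  by split; rewrite mem_gen // !inE eqxx ?orbT.
split; first by rewrite -morphJ // xz morph_expgz.
  by rewrite -morphV // -!morphM ?groupM ?groupV // yz morph_expgz.
by rewrite -morphR // -morphX // zg.
Qed.

Lemma eq_morph_gen (T rT : finGroupType) (S : {set T})
    (f g : {morphism [set: T] >-> rT}) :
  <<S>> = [set: T] -> {in S, f =1 g} -> f =1 g.
Proof.
move=> genS eq_fg t; pose E := [set t | f t == g t].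
have gE : group_set E.
  apply/group_setP; split=> [|u v]; first by rewrite inE !morph1.
  by rewrite !inE => /eqP fu /eqP fv; rewrite !morphM ?inE // fu fv.
suff : t \in Group gE by rewrite inE => /eqP.
suff /subsetP-> : [set: T] \subset Group gE by rewrite ?inE.
by rewrite -genS gen_subG; apply/subsetP=> u /eq_fg; rewrite inE => ->.
Qed.

(** * Conjugation relations and powers *)

Lemma conj_iter_expgz (T : finGroupType) (x c : T) (m : int) (j : nat) :
  x ^ c = expgz x m -> x ^ (c ^+ j) = expgz x (m ^+ j)%R.
Proof.
move=> xc; elim: j => [|j IHj]; first by rewrite expg0 conjg1 expr0 expgz1.
by rewrite expgS conjgM xc expgzJ IHj -expgzM exprSr.
Qed.

(** If c * x * c^-1 is the m-th power of x, then x ^ c is the m'-th power, m'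
    being an inverse of m modulo the order of x. *)
Lemma conj_inverse_expgz (T : finGroupType) (x c : T) (m m' : int) :
  (m * m' = 1 %[mod #[x]])%Z -> c * x * c^-1 = expgz x m -> x ^ c = expgz x m'.
Proof.
move=> mm' xc; have xE : x = expgz (x ^ c) m.
  by rewrite -expgzJ -xc !conjgE !mulgA mulVg mul1g mulgKV.
rewrite [in RHS]xE -expgzM -[LHS]expgz1; apply/esym/eq_expgz.
by rewrite orderJ.
Qed.

(** In a finite p-group, the relations make the commutator of x and y, raised to
    a power r inverse to k modulo the order of the group, act on x and y as the p ^ n-th iterate of
    x |-> x ^ alpha, y |-> y ^ mu; and that power of the commutator commutes
    with the commutator. *)
Lemma comm_expgz_pn (T : finGroupType) (p : nat) (x y : T)
    (alpha beta mu : int) (gamma n k : nat) :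
  prime p -> p.-group [set: T] ->
  gamma = (p ^ n * k)%N -> ~~ (p %| k) ->
  (p %| (alpha - 1)%R)%Z -> (p %| (beta - 1)%R)%Z ->
  (beta * mu = 1 %[mod #[y]])%Z ->
  macdonald_rel alpha beta gamma x y ->
  [~ expgz x (alpha ^+ (p ^ n))%R, expgz y (mu ^+ (p ^ n))%R] = [~ x, y].
Proof.
move=> p_pr pT -> p'k p_alpha p_beta mu_inv [xc yc].
have [N oT] := p_natP pT.
have ord_pN (z : T) : #[z] %| p ^ N by rewrite -oT order_dvdG ?inE.
have yc' := conj_inverse_expgz (expr_inv_mod (p ^ n * k) mu_inv) yc.
have x_fix := expgz_pX (ord_pN x) p_alpha.
have y_fix : expgz y (mu ^+ (p ^ N))%R = y.
  rewrite -[in LHS](expgz_pX (ord_pN y) p_beta) -expgzM -[RHS]expgz1.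
  exact: eq_expgz (expr_inv_mod _ mu_inv).
have k_gt0 : (0 < k)%N by rewrite lt0n; apply: contraNneq p'k => ->; rewrite dvdn0.
(* r * k = s * p ^ N + 1, with p ^ N a multiple of all element orders *)
have [r s rs _] := egcdnP (p ^ N) k_gt0.
have coKP : gcdn k (p ^ N) = 1%N.
  by apply/eqP; rewrite -/(coprime _ _) coprimeXr // coprime_sym prime_coprime.
have split_exp (m : int) : (m ^+ (p ^ n * k) ^+ r =
    (m ^+ (p ^ N)) ^+ (s * p ^ n) * m ^+ (p ^ n))%R.
  rewrite -!exprM -exprD; congr (_ ^+ _)%R.
  rewrite -mulnA [(k * r)%N]mulnC rs coKP mulnDr muln1.
  by rewrite [(p ^ n * _)%N]mulnC [(s * p ^ N)%N]mulnC -mulnA.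
have c_fix : [~ x, y] ^ ([~ x, y] ^+ r) = [~ x, y].
  by apply/conjg_fixP/commgP/commuteX.
have xr : x ^ ([~ x, y] ^+ r) = expgz x (alpha ^+ (p ^ n))%R.
  by rewrite (conj_iter_expgz r xc) split_exp expgzM (expgz_exp1 _ x_fix).
have yr : y ^ ([~ x, y] ^+ r) = expgz y (mu ^+ (p ^ n))%R.
  by rewrite (conj_iter_expgz r yc') split_exp expgzM (expgz_exp1 _ y_fix).
by rewrite -xr -yr -conjRg c_fix.
Qed.

(** * Solving the Wamsley relations over a quotient of the Macdonald group *)

(** A version of the factor theorem whose result has the full type as its
    domain. *)
Lemma factor_morphism (G H K : finGroupType) (pi : {morphism [set: G] >-> H})
    (f : {morphism [set: G] >-> K}) :
  pi @* [set: G] = [set: H] -> 'ker pi \subset 'ker f ->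
  exists zeta : {morphism [set: H] >-> K}, forall g, zeta (pi g) = f g.
Proof.
move=> pi_onto sKK; pose z h := factm sKK (subxx _) h.
have zM : {in [set: H] &, {morph z : h h' / h * h'}}.
  by move=> h h' _ _; rewrite /z morphM //= pi_onto inE.
by exists (Morphism zM) => g; rewrite /= /z factmE ?inE.
Qed.

Lemma morph_macdonald_rel (T T' : finGroupType) (f : {morphism [set: T] >-> T'})
    (alpha beta : int) (gamma : nat) (x y : T) :
  macdonald_rel alpha beta gamma x y ->
  macdonald_rel alpha beta gamma (f x) (f y).
Proof.
case=> xc yc; split; rewrite -!(morphR, morphV, morphM, morphJ) ?inE //.
  by rewrite xc morph_expgz ?inE.
by rewrite yc morph_expgz ?inE.
Qed.

(** A finite quotient [H] of the Macdonald group embeds in a finite group that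
    contains an element w completing the images of A and B to a solution of the
    Wamsley relations, as soon as A |-> A ^ alpha, B |-> B ^ mu defines an
    endomorphism of [H] that fixes the commutator. *)
Lemma wamsley_extension (gT H : finGroupType) (A B : gT)
    (alpha beta mu : int) (gamma : nat) (pi : {morphism [set: gT] >-> H}) :
  (0 < gamma)%N -> is_macdonald alpha beta gamma A B ->
  pi @* [set: gT] = [set: H] ->
  (beta * mu = 1 %[mod #[pi B]])%Z ->
  [~ expgz (pi A) alpha, expgz (pi B) mu] = [~ pi A, pi B] ->
  (forall f : {morphism [set: gT] >-> H},
    f A = expgz (pi A) alpha -> f B = expgz (pi B) mu ->
    'ker pi \subset 'ker f) ->
  exists (E : finGroupType) (R : {morphism [set: H] >-> E}) (w : E),
    'injm R /\ wamsley_rel alpha beta gamma (R (pi A)) (R (pi B)) w.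
Proof.
move=> gamma_gt0 presG pi_onto mu_inv comm_1 ker_f; have [relG _ _] := presG.
have relH := morph_macdonald_rel pi relG; have [xc yc] := relH.
set x := pi A in mu_inv comm_1 ker_f relH xc yc *.
set y := pi B in mu_inv comm_1 ker_f relH xc yc *.
have rel_f : macdonald_rel alpha beta gamma (expgz x alpha) (expgz y mu).
  rewrite /macdonald_rel comm_1; split.
    by rewrite expgzJ xc -!expgzM mulrC.
  rewrite -{1}[[~ x, y]]invgK -mulgA -conjgE expgzJ.
  by rewrite conjgE invgK mulgA yc -!expgzM mulrC.
(* zeta is the endomorphism x |-> x ^ alpha, y |-> y ^ mu of H *)
have [f [fA fB]] := presented2_morphism presG rel_f.
have [zeta zetaE] := factor_morphism pi_onto (ker_f f fA fB).
have zx : zeta x = expgz x alpha by rewrite /x zetaE.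
have zy : zeta y = expgz y mu by rewrite /y zetaE.
have zc : zeta [~ x, y] = [~ x, y] by rewrite morphR ?inE // zx zy.
have iter_x i : iter i zeta x = expgz x (alpha ^+ i)%R.
  elim: i => [|i IHi]; first by rewrite expr0 expgz1.
  by rewrite iterS IHi morph_expgz ?inE // zx -expgzM exprS.
have iter_y i : iter i zeta y = expgz y (mu ^+ i)%R.
  elim: i => [|i IHi]; first by rewrite expr0 expgz1.
  by rewrite iterS IHi morph_expgz ?inE // zy -expgzM exprS.
have genH : <<[set x; y]>> = [set: H].
  rewrite -pi_onto -[X in _ = pi @* X](is_macdonald_gen presG) morphim_gen ?subsetT //.
  by rewrite morphimU !morphim_set1 ?inE.
have yc' := conj_inverse_expgz (expr_inv_mod gamma mu_inv) yc.
have iterM i : {in [set: H] &, {morph iter i zeta : h h' / h * h'}}.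
  by elim: i => //= i IHi h h' _ _; rewrite IHi ?inE // morphM ?inE.
(* both sides are endomorphisms, and they agree on the generators x and y *)
have z_iter : iter gamma zeta =1 (fun h => h ^ [~ x, y]).
  have conjM : {in [set: H] &, {morph conjg^~ [~ x, y] : h h' / h * h'}}.
    by move=> h h' _ _; rewrite conjMg.
  apply: (@eq_morph_gen _ _ _ (Morphism (iterM gamma)) (Morphism conjM) genH).
  by move=> h; rewrite !inE => /orP[]/eqP->; rewrite /= ?iter_x ?iter_y.
case: gamma gamma_gt0 z_iter {presG relG relH xc yc yc' rel_f} => // g _ z_iter.
have [E [R [w [injR Rw wg]]]] := cyclic_extension zc z_iter.
exists E, R, w; split=> //; split.
- by rewrite Rw zx morph_expgz ?inE.
- have yE : y = zeta (expgz y beta).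
    rewrite morph_expgz ?inE // zy -expgzM mulrC -[LHS]expgz1.
    exact/esym/eq_expgz.
  by rewrite [in LHS]yE -Rw morph_expgz ?inE // conjgE !mulgA mulgV mul1g mulgK.
- by rewrite wg morphR ?inE.
Qed.

(** * The Sylow projection in a nilpotent group *)

Lemma expgz_constt (T : finGroupType) (pi : nat_pred) (x : T) (m : int) :
  (expgz x m).`_pi = expgz x.`_pi m.
Proof. by case: m => m /=; rewrite ?consttV consttX. Qed.

Section SylowProjection.

Variables (gT : finGroupType) (p : nat) (P : {group gT}).
Hypotheses (nilG : nilpotent [set: gT]) (sylP : p.-Sylow([set: gT]) P).

Lemma sylow_pcore_dprod : P \x 'O_p^'([set: gT]) = [set: gT].
Proof.
by rewrite (nilpotent_Hall_pcore nilG sylP); apply: nilpotent_pcoreC.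
Qed.

Lemma sylow_constt (x : gT) : x.`_p \in P.
Proof.
rewrite (mem_normal_Hall sylP) ?inE ?p_elt_constt //.
by rewrite (nilpotent_Hall_pcore nilG sylP) pcore_normal.
Qed.

Lemma sylow_constt' (x : gT) : x.`_p^' \in 'O_p^'([set: gT]).
Proof.
by rewrite (mem_normal_Hall (nilpotent_pcore_Hall _ nilG)) ?pcore_normal ?inE ?p_elt_constt.
Qed.

(** In a nilpotent group, the projection onto the Sylow p-subgroup sends x to
    its p-part, which is a power of x. *)
Lemma sylow_projE (x : gT) : sylow_proj p P x = x.`_p.
Proof.
have [_ _ _ tiPO] := dprodP sylow_pcore_dprod.
by rewrite /sylow_proj -{1}(consttC p x) divgrMid ?sylow_constt ?sylow_constt'.
Qed.

(** In a nilpotent group, taking p-parts is a morphism; hence it commutes with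
    commutators. *)
Lemma consttR (x y : gT) : [~ x.`_p, y.`_p] = [~ x, y].`_p.
Proof.
have [_ _ cPO tiPO] := dprodP sylow_pcore_dprod.
have M (u v : gT) : (u * v).`_p = u.`_p * v.`_p.
  rewrite -!sylow_projE /sylow_proj (@divgrM _ P 'O_p^'([set: gT])%G [set: gT]%G) ?in_setT //.
  by apply/complP; have [_ -> _ _] := dprodP sylow_pcore_dprod.
by rewrite commgEl conjgE !M !consttV.
Qed.

End SylowProjection.

Lemma class_support_sub (gT : finGroupType) (A : {set gT}) (G : {group gT}) :
  A \subset class_support A G.
Proof. by apply/subsetP=> x Ax; apply/imset2P; exists x 1; rewrite ?conjg1. Qed.

Lemma normal_closure_norm (gT : finGroupType) (A : {set gT}) (G : {group gT}) :
  G \subset 'N(normal_closure A G).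
Proof. exact: norms_gen (class_support_norm A G). Qed.

Lemma pcore_ker_pgroup (gT H : finGroupType) (p : nat)
    (f : {morphism [set: gT] >-> H}) :
  p.-group [set: H] -> 'O_p^'([set: gT]) \subset 'ker f.
Proof.
move=> pH; rewrite ker_trivg_morphim subsetT /=.
have p'O : p^'.-group (f @* 'O_p^'([set: gT])) by rewrite morphim_pgroup ?pcore_pgroup.
have pO : p.-group (f @* 'O_p^'([set: gT])) by apply: pgroupS pH; rewrite subsetT.
by rewrite (card1_trivg (pnat_1 pO p'O)).
Qed.

(** * The kernel on the Sylow subgroup *)

Section SylowKernel.

Variables (alpha beta mu : int) (gamma p n k : nat).
Variables (gT : finGroupType) (A B : gT) (P : {group gT}).
Hypotheses (gamma_gt0 : (0 < gamma)%N) (p_pr : prime p).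
Hypotheses (nilG : nilpotent [set: gT]) (sylP : p.-Sylow([set: gT]) P).
Hypothesis presG : is_macdonald alpha beta gamma A B.

Let a := A.`_p.
Let b := B.`_p.
Let M := normal_closure (comm_quotients alpha mu (p ^ n) a b) P.

Hypothesis mu_inv : (beta * mu = 1 %[mod #[b]])%Z.

Let Pa : a \in P. Proof. exact: sylow_constt. Qed.
Let Pb : b \in P. Proof. exact: sylow_constt. Qed.

Lemma comm_quotients_sub : comm_quotients alpha mu (p ^ n) a b \subset P.
Proof.
apply/subsetP=> _ /imsetP[i _ ->].
by rewrite !(groupM, groupV, groupR, mem_expgz).
Qed.

Lemma normal_closure_sub : M \subset P.
Proof.
by rewrite gen_subG class_support_sub_norm ?comm_quotients_sub ?normG.
Qed.

(** The images of a and b are powers of X and Y, so Z raises them to the powers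
    alpha and mu; their commutator is the p-part of Z ^ gamma, so Z centralises
    it. Therefore each generator of the normal closure is killed. *)
Lemma normal_closure_sub_ker (wT : finGroupType) (X Y Z : wT)
    (Omega : {morphism [set: gT] >-> wT}) :
  wamsley_rel alpha beta gamma X Y Z -> Omega A = X -> Omega B = Y ->
  M \subset 'ker Omega :&: P.
Proof.
move=> [Xz Yz Zg] OA OB; rewrite subsetI normal_closure_sub andbT gen_subG.
apply: class_support_sub_norm; last first.
  by apply: subset_trans (subsetT _) _; apply: ker_norm.
have Oa : Omega a = X.`_p by rewrite /a morph_constt ?inE // OA.
have Ob : Omega b = Y.`_p by rewrite /b morph_constt ?inE // OB.
have aZ : Omega a ^ Z = expgz (Omega a) alpha.
  by rewrite Oa -consttJ Xz expgz_constt.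
have bZ : Omega b ^ Z = expgz (Omega b) mu.
  apply: (@conj_inverse_expgz _ _ _ beta); last first.
    by rewrite Ob -expgz_constt -Yz -{1}[Z]invgK -mulgA -conjgE -consttJ conjgE invgK mulgA.
  apply/eqP; rewrite eqz_mod_dvd.
  apply: (@dvdz_trans #[b]); first by rewrite dvdzE morph_order ?inE.
  by rewrite -eqz_mod_dvd; apply/eqP.
have commZ : [~ Omega a, Omega b] ^ Z = [~ Omega a, Omega b].
  rewrite -morphR ?inE // /a /b (consttR nilG sylP) morph_constt ?inE //.
  rewrite morphR ?inE // OA OB -Zg -consttJ; congr (_.`_p).
  by apply/conjg_fixP/commgP/commute_sym/commuteX.
apply/subsetP=> _ /imsetP[i _ ->]; apply/kerP; first by rewrite inE.
rewrite morphM ?inE // morphV ?inE // !morphR ?inE // !morph_expgz ?inE //.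
rewrite -(conj_iter_expgz i aZ) -(conj_iter_expgz i bZ) -conjRg.
suff -> : [~ Omega a, Omega b] ^ (Z ^+ i) = [~ Omega a, Omega b].
  by rewrite mulgV.
by apply/conjg_fixP/commgP/commuteX/commgP/conjg_fixP.
Qed.

Hypotheses (def_gamma : gamma = (p ^ n * k)%N) (p'k : ~~ (p %| k)).
Hypotheses (p_alpha : (p %| (alpha - 1)%R)%Z) (p_beta : (p %| (beta - 1)%R)%Z).

Let O := 'O_p^'([set: gT]).
(** The kernel of the composite of the projections of G onto P and P / M. *)
Let K := (<<class_support (comm_quotients alpha mu (p ^ n) a b) P>> <*> O)%G.

Let nKG : [set: gT] \subset 'N(K).
Proof.
have [_ defG cPO _] := dprodP (sylow_pcore_dprod nilG sylP).
apply: normsY; last exact: gFnorm.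
suff : P * O \subset 'N(M) by rewrite defG.
rewrite mul_subG ?normal_closure_norm //.
apply: subset_trans cPO _; apply: subset_trans (cent_sub _).
exact: centS normal_closure_sub.
Qed.

Let pgroup_quotient : p.-group [set: coset_of K].
Proof.
have [_ defG cPO _] := dprodP (sylow_pcore_dprod nilG sylP).
have OK : O \subset K by apply: joing_subr.
have -> : [set: coset_of K] = P / K.
  rewrite -quotientT; transitivity ((P * O) / K); first by rewrite defG.
  by rewrite quotientMl ?(subset_trans (subsetT P)) // (quotientS1 OK) mulg1.
by rewrite quotient_pgroup // (pHall_pgroup sylP).
Qed.

(** The quotient of G by [K] is P / M. It embeds in a group where the images of A
    and B satisfy the Wamsley relations with some w, so that the kernel of the
    map from G to W is contained in [K]; and the intersection of [K] with P
    is M. *)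
Lemma ker_sub_normal_closure (wT : finGroupType) (X Y Z : wT)
    (Omega : {morphism [set: gT] >-> wT}) :
  is_wamsley alpha beta gamma X Y Z -> Omega A = X -> Omega B = Y ->
  'ker Omega :&: P \subset M.
Proof.
move=> presW OA OB.
pose pi := [morphism of restrm nKG (coset K)].
have pi_onto : pi @* [set: gT] = [set: coset_of K].
  by rewrite /= morphim_restrm setIid -quotientE quotientT.
have kerpi : 'ker pi = K by rewrite ker_restrm ker_coset; apply/setIidPr/subsetT.
have Kpi u : u \in K -> pi u = 1.
  by move=> Ku; apply/kerP; rewrite ?in_setT // kerpi.
have pH (h : coset_of K) : h.`_p = h.
  by rewrite constt_p_elt //; apply: mem_p_elt pgroup_quotient _; rewrite inE.
have pi_a : pi a = pi A by rewrite /a morph_constt ?inE.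
have pi_b : pi b = pi B by rewrite /b morph_constt ?inE.
have relH : macdonald_rel alpha beta gamma (pi A) (pi B).
  by apply: morph_macdonald_rel; case: presG.
have mu_inv' : (beta * mu = 1 %[mod #[pi B]])%Z.
  apply/eqP; rewrite eqz_mod_dvd.
  apply: (@dvdz_trans #[b]); first by rewrite dvdzE -pi_b morph_order ?inE.
  by rewrite -eqz_mod_dvd; apply/eqP.
have comm_pn := comm_expgz_pn p_pr pgroup_quotient def_gamma p'k p_alpha
  p_beta mu_inv' relH.
(* the case i = p ^ n is comm_pn, and the others hold by definition of K *)
have comm_i i : (i <= p ^ n)%N ->
    [~ expgz (pi A) (alpha ^+ i)%R, expgz (pi B) (mu ^+ i)%R]
      = [~ pi A, pi B].
  rewrite leq_eqVlt => /orP[/eqP-> // | lt_i].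
  case: (posnP i) => [-> | i_gt0]; first by rewrite !expr0 !expgz1.
  rewrite -pi_a -pi_b -!morph_expgz ?inE // -!morphR ?inE //.
  apply/eqP; rewrite eq_mulgV1 -morphV ?inE // -morphM ?inE //; apply/eqP.
  apply: Kpi; apply/(subsetP (joing_subl _ _))/mem_gen.
  apply: (subsetP (class_support_sub _ _)).
  by apply/imsetP; exists (Ordinal lt_i); rewrite ?inE.
have comm_1 : [~ expgz (pi A) alpha, expgz (pi B) mu] = [~ pi A, pi B].
  by have := comm_i 1%N; rewrite !expr1; apply; rewrite expn_gt0 prime_gt0.
have ker_f (f : {morphism [set: gT] >-> coset_of K}) :
    f A = expgz (pi A) alpha -> f B = expgz (pi B) mu ->
  'ker pi \subset 'ker f.
  move=> fA fB; rewrite kerpi join_subG pcore_ker_pgroup ?pgroup_quotient // andbT.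
  rewrite gen_subG; apply: class_support_sub_norm; last first.
    by apply: subset_trans (subsetT _) _; apply: ker_norm.
  have fa : f a = expgz (pi A) alpha by rewrite /a morph_constt ?inE // fA.
  have fb : f b = expgz (pi B) mu by rewrite /b morph_constt ?inE // fB.
  apply/subsetP=> _ /imsetP[i _ ->]; apply/kerP; first by rewrite inE.
  rewrite morphM ?inE // morphV ?inE // !morphR ?inE // !morph_expgz ?inE //.
  by rewrite fa fb -!expgzM -!exprS comm_i ?ltn_ord // comm_1 mulgV.
have [E [R [w [injR relE]]]] :=
  wamsley_extension gamma_gt0 presG pi_onto mu_inv' comm_1 ker_f.
have [g [gX gY gZ]] := presented3_morphism presW relE.
have eq_gR : forall u, g (Omega u) = R (pi u).
  have gM : {in [set: gT] &, {morph (fun u => g (Omega u)) : u v / u * v}}.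
    by move=> u v _ _; rewrite !morphM ?inE.
  have RM : {in [set: gT] &, {morph (fun u => R (pi u)) : u v / u * v}}.
    by move=> u v _ _; rewrite !morphM ?inE.
  apply: (@eq_morph_gen _ _ _ (Morphism gM) (Morphism RM) (is_macdonald_gen presG)).
  by move=> u; rewrite !inE => /orP[]/eqP->; rewrite /= ?OA ?OB.
apply/subsetP=> u /setIP[/kerP Ou Pu].
have : u \in K.
  suff : u \in 'ker pi by rewrite kerpi.
  apply/kerP; first by rewrite inE.
  apply: (injmP injR); rewrite ?inE // morph1 -eq_gR Ou ?inE //.
  by rewrite morph1.
have [_ _ cPO tiPO] := dprodP (sylow_pcore_dprod nilG sylP).
rewrite /= cent_joinEr; last exact: subset_trans cPO (centS normal_closure_sub).
case/mulsgP=> m o Mm Oo def_u; suff o1 : o = 1 by rewrite def_u o1 mulg1.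
apply/set1gP; rewrite -tiPO inE Oo andbT.
by rewrite -(groupMl _ (subsetP normal_closure_sub _ Mm)) -def_u.
Qed.

End SylowKernel.

(** * The Sylow subgroup of the Wamsley group *)

Section WamsleyXY.

Variables (alpha beta : int) (gamma : nat) (T : finGroupType) (X Y Z : T).
Hypothesis presW : is_wamsley alpha beta gamma X Y Z.

Let S := (<[X]> <*> <[Y]>)%G.

Lemma wamsley_norm : Z \in 'N(S).
Proof.
have [[Xz Yz _] _ _] := presW; apply: (subsetP (normsY _ _) Z (set11 Z)).
  by rewrite sub1set inE -cycleJ Xz cycle_subG mem_expgz ?cycle_id.
rewrite sub1set -groupV inE -cycleJ cycle_subG conjgE invgK mulgA Yz.
by rewrite mem_expgz ?cycle_id.
Qed.

Lemma wamsley_gen : S <*> <[Z]> = [set: T].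
Proof.
apply/eqP; rewrite eqEsubset subsetT -(is_wamsley_gen presW) gen_subG.
apply/subsetP=> u; rewrite !inE -orbA => /or3P[]/eqP->.
- by rewrite (subsetP (joing_subl _ _)) // (subsetP (joing_subl _ _)) ?cycle_id.
- by rewrite (subsetP (joing_subl _ _)) // (subsetP (joing_subr _ _)) ?cycle_id.
- by rewrite (subsetP (joing_subr _ _)) ?cycle_id.
Qed.

Lemma wamsley_normal : S <| [set: T].
Proof.
rewrite /normal subsetT -wamsley_gen join_subG normG.
by rewrite cycle_subG wamsley_norm.
Qed.

Lemma wamsley_index : #|[set: T] : S| %| gamma.
Proof.
rewrite -card_quotient ?normal_norm ?wamsley_normal //.
rewrite -[X in X / _]wamsley_gen quotientYidl ?cycle_subG ?wamsley_norm //.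
rewrite quotient_cycle ?wamsley_norm // -orderE order_dvdn -morphX ?wamsley_norm //.
have [[_ _ ->] _ _] := presW; apply/eqP/coset_id; rewrite groupR //.
  by rewrite (subsetP (joing_subl _ _)) ?cycle_id.
by rewrite (subsetP (joing_subr _ _)) ?cycle_id.
Qed.

(** The subgroup S generated by X and Y is normal with index dividing gamma. When
    S is nilpotent, its Sylow p-subgroup is characteristic in S, hence normal in
    the whole group; it is a Sylow p-subgroup there if p does not divide gamma. *)
Lemma wamsley_Sylow (p : nat) (P : {group T}) :
  prime p -> ~~ (p %| gamma) -> nilpotent S -> p.-Sylow(S) P ->
  'Syl_p([set: T]) = [set P].
Proof.
move=> p_pr p'gamma nilS sylP.
have sylPT : p.-Sylow([set: T]) P.
  have [sPS pP p'i] := and3P sylP.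
  rewrite /pHall subsetT pP /=.
  rewrite -(Lagrange_index (subsetT S) sPS) pnatM p'i andbT.
  rewrite p'natE //; apply: contra p'gamma => p_dvd.
  exact: dvdn_trans p_dvd wamsley_index.
have defP : P :=: 'O_p([set: T]).
  apply/eqP; rewrite eqEsubset; apply/andP; split.
    apply: pcore_max; first exact: pHall_pgroup sylP.
    rewrite (nilpotent_Hall_pcore nilS sylP).
    exact: gFnormal_trans wamsley_normal.
  exact: pcore_sub_Hall sylPT.
apply/setP=> Q; rewrite !inE; apply/idP/eqP=> [sylQ | -> //].
have hallO : p.-Sylow([set: T]) 'O_p([set: T]) by rewrite -defP.
by apply: val_inj; rewrite /= defP (eq_Hall_pcore hallO sylQ).
Qed.

End WamsleyXY.

Theorem theorem2p4
  (alpha beta : int) (gamma : nat)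
  (gamma_gt0 : (0 < gamma)%N)
  (alpha_neq1 : (alpha ^+ gamma)%R <> 1%R)
  (beta_neq1 : (beta ^+ gamma)%R <> 1%R)
  (* the finite Wamsley group W *)
  (wT : finGroupType) (X Y Z : wT)
  (W_pres : is_wamsley alpha beta gamma X Y Z)
  (* the finite nilpotent Macdonald group G *)
  (gT : finGroupType) (A B : gT)
  (G_pres : is_macdonald alpha beta gamma A B)
  (G_nil : nilpotent [set: gT])
  (Omega : {morphism [set: gT] >-> wT})
  (Omega_A : Omega A = X) (Omega_B : Omega B = Y)
  (p : nat) (p_prime : prime p)
  (Gp : {group gT}) (Gp_sylow : p.-Sylow([set: gT]) Gp)
  (a b : gT)
  (a_def : a = sylow_proj p Gp A) (b_def : b = sylow_proj p Gp B)
  (mu : int) (mu_inv : (beta * mu = 1 %[mod #[b]])%Z)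
  (n k : nat) (gamma_eq : gamma = (p ^ n * k)%N) (p_ndvd_k : ~~ (p %| k)%N)
  (p_alpha : (p %| (alpha - 1)%R)%Z) (p_beta : (p %| (beta - 1)%R)%Z) :
  normal_closure (comm_quotients alpha mu (p ^ n) a b) Gp = 'ker Omega :&: Gp
  /\ (~~ (p %| gamma)%N ->
      exists f : {morphism Gp >-> wT},
        'injm f /\ 'Syl_p([set: wT]) = [set (f @* Gp)%G]).
Proof.
rewrite (sylow_projE G_nil Gp_sylow) in a_def.
rewrite (sylow_projE G_nil Gp_sylow) in b_def.
rewrite {a}a_def; rewrite {b}b_def in mu_inv *.
have [W_rel _ _] := W_pres.
have M_eq_N : normal_closure (comm_quotients alpha mu (p ^ n) A.`_p B.`_p) Gp
    = 'ker Omega :&: Gp.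
  apply/eqP; rewrite eqEsubset.
  rewrite (normal_closure_sub_ker n G_nil Gp_sylow mu_inv W_rel Omega_A Omega_B).
  exact: (ker_sub_normal_closure gamma_gt0 p_prime G_nil Gp_sylow G_pres mu_inv
    gamma_eq p_ndvd_k p_alpha p_beta W_pres Omega_A Omega_B).
split=> // p'gamma; have n0 : n = 0%N.
  case: n gamma_eq {M_eq_N} => // n def_gamma.
  by rewrite def_gamma expnS -mulnA dvdn_mulr in p'gamma.
(* for n = 0 there are no commutator quotients *)
have M1 : normal_closure (comm_quotients alpha mu (p ^ n) A.`_p B.`_p) Gp = 1.
  apply/trivgP; rewrite gen_subG class_support_sub_norm ?norms1 //.
  apply/subsetP=> u /imsetP[[i lt_i]]; rewrite inE /=.
  by rewrite n0 expn0 ltnS leqn0 in lt_i; rewrite (eqP lt_i).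
exists (restrm (subsetT Gp) Omega); split.
  by rewrite ker_restrm setIC -M_eq_N M1.
have im_Omega : Omega @* [set: gT] = <[X]> <*> <[Y]>.
  rewrite -[X in Omega @* X](is_macdonald_gen G_pres) morphim_gen ?subsetT //.
  by rewrite morphimU !morphim_set1 ?inE // Omega_A Omega_B -joingE -joing_idl -joing_idr.
have -> : (restrm (subsetT Gp) Omega @* Gp)%G = (Omega @* Gp)%G.
  by apply: val_inj; rewrite /= morphim_restrm setIid.
apply: (wamsley_Sylow W_pres p_prime p'gamma).
  by rewrite /= -im_Omega morphim_nil.
by rewrite /= -im_Omega morphim_pHall ?subsetT.
Qed.
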